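(* Let $H,K$ be complex Hilbert spaces and let $T\in CR(H,K)$ be a closed range linear relation with $D(T)=H$. Define $$\mathcal{A}=\begin{bmatrix} 0 & T^\dagger \\ T & 0 \end{bmatrix}=\bigl\{\{(x,y),(T^\dagger y,\,z)\}:\{x,z\}\in T,\ y\in K\bigr\},$$ a linear relation in $H\times K$. Then: (1) $\sigma_{e_1}(\mathcal{A})=\{\lambda\in\mathbb{C}:\lambda^2\in\sigma_{e_1}(TT^\dagger)\cup\sigma_{e_1}(T^\dagger T)\}$. (2) $\sigma_{e_2}(\mathcal{A})=\{\lambda\in\mathbb{C}:\lambda^2\in\sigma_{e_2}(TT^\dagger)\cup\sigma_{e_2}(T^\dagger T)\}$. (3) $\sigma_{e_3}(\mathcal{A})=\bigl\{\lambda\in\mathbb{C}:\lambda^2\in\sigma_{e_3}(TT^\dagger)\cup\sigma_{e_3}(T^\dagger T)\cup[\sigma_{e_1}(T^\dagger T)\cap\sigma_{e_2}(TT^\dagger)]\cup[\sigma_{e_2}(T^\dagger T)\cap\sigma_{e_1}(TT^\dagger)]\bigr\}$. (4) $\sigma_{e_4}(\mathcal{A})=\{\lambda\in\mathbb{C}:\lambda^2\in\sigma_{e_4}(TT^\dagger)\cup\sigma_{e_4}(T^\dagger T)\}$.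
   Context: A linear relation from a Hilbert space $H$ into a Hilbert space $K$ is a linear subspace $T$ of $H\times K$, whose elements are written $\{x,y\}$; $CR(H,K)$ is the set of those that are closed subspaces. $D(T)=\{x:\{x,y\}\in T\text{ for some }y\}$, $R(T)=\{y:\{x,y\}\in T\text{ for some }x\}$, $N(T)=\{x:\{x,0\}\in T\}$, $T^{-1}=\{\{y,x\}:\{x,y\}\in T\}$. Operators are identified with their graphs. Products: $TS=\{\{x,y\}:\{x,z\}\in S,\ \{z,y\}\in T\text{ for some }z\}$. $P_W$ is the orthogonal projection onto a closed subspace $W$. The Moore–Penrose inverse of $T\in CR(H,K)$ is $T^\dagger=P_{N(T)^\perp}T^{-1}P_{R(T)}$ with domain $R(T)\oplus R(T)^\perp$; it is an operator, and has domain $K$ when $R(T)$ is closed. For $\lambda\in\mathbb{C}$, $S-\lambda I=\{\{x,y-\lambda x\}:\{x,y\}\in S\}$. $\phi_+(H,K)$ is the set of closed linear relations with closed range and $\dim N(T)<\infty$; $\phi_-(H,K)$ is the set of closed linear relations whose range is a closed subspace of $K$ of finite codimension. For a closed linear relation $S$ in a Hilbert space $X$, writing $\phi_\pm=\phi_\pm(X,X)$: $\sigma_{e_1}(S)=\{\lambda\in\mathbb{C}:S-\lambda I\notin\phi_+\}$, $\sigma_{e_2}(S)=\{\lambda\in\mathbb{C}:S-\lambda I\notin\phi_-\}$, $\sigma_{e_3}(S)=\{\lambda\in\mathbb{C}:S-\lambda I\notin\phi_+\cup\phi_-\}$, $\sigma_{e_4}(S)=\{\lambda\in\mathbb{C}:S-\lambda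 I\notin\phi_+\cap\phi_-\}$. $H\times K$ is the Hilbert space direct sum. *)

(* Defs.v *)
From HB Require Import structures.
From mathcomp Require Import all_boot all_order all_algebra complex.
From mathcomp Require Import all_classical all_reals all_analysis.

Set Implicit Arguments.
Unset Strict Implicit.
Unset Printing Implicit Defensive.
Import Order.TTheory GRing.Theory Num.Theory.
Import numFieldNormedType.Exports.
Local Open Scope classical_set_scope.
Local Open Scope ring_scope.
Local Open Scope complex_scope.

(** Complex Hilbert spaces.  The inner product is linear in its first argument
    and conjugate-linear in its second one; positive definiteness is part of
    the type [{dot H for _}]. *)
HB.mixin Record NormedModule_isHilbert (R : realType) H
    & NormedModule R[i] H := {
  hdot : {dot H for (@Num.conj R[i])} ;
  sqr_hnormE : forall x : H, `|x| ^+ 2 = hdot x x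
}.

#[short(type="hilbertType")]
HB.structure Definition Hilbert (R : realType) :=
  {H of CompleteNormedModule R[i] H & NormedModule_isHilbert R H}.

(** The Hilbert space direct sum.  This is an alias of [H * K], because the
    product type itself carries the maximum norm in the library. *)
Definition hsum (R : realType) (H K : hilbertType R) : Type := (H * K)%type.

Section HilbertSum.
Context {R : realType} (H K : hilbertType R).
Local Notation C := R[i].
Local Notation V := (hsum H K).

HB.instance Definition _ := GRing.Lmodule.copy V (H * K)%type.

Definition hsum_norm (p : V) : C := sqrtC (`|p.1| ^+ 2 + `|p.2| ^+ 2).

Lemma hsum_normE (p : V) : hsum_norm p = `| `|p.1| + 'i * `|p.2| |.
Proof. by rewrite normC_rect ?normr_real. Qed.

Lemma hsum_normD (p q : V) : hsum_norm (p + q) <= hsum_norm p + hsum_norm q.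
Proof.
rewrite (hsum_normE p) (hsum_normE q).
apply: le_trans (ler_normD _ _).
rewrite addrACA -mulrDr normC_rect ?rpredD ?normr_real// /hsum_norm.
rewrite ler_sqrtC ?qualifE/= ?addr_ge0 ?exprn_ge0 ?addr_ge0//.
by apply: lerD; rewrite lerXn2r ?qualifE/= ?addr_ge0 ?ler_normD.
Qed.

Lemma hsum_normZ (l : C) (p : V) : hsum_norm (l *: p) = `|l| * hsum_norm p.
Proof. by rewrite !hsum_normE/= !normrZ mulrCA -mulrDr normrM normr_id. Qed.

Lemma hsum_norm_eq0 (p : V) : hsum_norm p = 0 -> p = 0.
Proof.
move/eqP; rewrite sqrtC_eq0 paddr_eq0 ?exprn_ge0// !sqrf_eq0 !normr_eq0.
by case: p => x y /= /andP[/eqP-> /eqP->].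
Qed.

HB.instance Definition _ :=
  @Lmodule_isNormed.Build C V hsum_norm hsum_normD hsum_normZ hsum_norm_eq0.

Lemma sqr_hsum_norm (p : V) : `|p| ^+ 2 = `|p.1| ^+ 2 + `|p.2| ^+ 2.
Proof. by rewrite /Num.norm/= sqrtCK. Qed.

Lemma hsum_norm_fst (p : V) : `|p.1| <= `|p|.
Proof.
rewrite -(@ler_pXn2r _ 2)// ?qualifE/= ?normr_ge0//.
by rewrite sqr_hsum_norm lerDl exprn_ge0.
Qed.

Lemma hsum_norm_snd (p : V) : `|p.2| <= `|p|.
Proof.
rewrite -(@ler_pXn2r _ 2)// ?qualifE/= ?normr_ge0//.
by rewrite sqr_hsum_norm lerDr exprn_ge0.
Qed.

Lemma hsum_norm_le (p : V) : `|p| <= `|p.1| + `|p.2|.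
Proof.
rewrite -(@ler_pXn2r _ 2)// ?qualifE/= ?addr_ge0//.
by rewrite sqr_hsum_norm sqrrD addrAC lerDl mulrn_wge0 ?mulr_ge0.
Qed.

Lemma hsum_complete (F : set_system V) : ProperFilter F -> cauchy F -> cvg F.
Proof.
move=> FF /cauchy_ballP Fc.
have c1 : cvg (fst @ F).
  apply: cauchy_cvg; apply/cauchy_ballP => e e0.
  rewrite near_map2; apply: filterS (Fc e e0) => -[p q]/=.
  rewrite -!ball_normE/=; apply: le_lt_trans.
  exact: (hsum_norm_fst (p - q)).
have c2 : cvg (snd @ F).
  apply: cauchy_cvg; apply/cauchy_ballP => e e0.
  rewrite near_map2; apply: filterS (Fc e e0) => -[p q]/=.
  rewrite -!ball_normE/=; apply: le_lt_trans.
  exact: (hsum_norm_snd (p - q)).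
apply/cvg_ex; exists ((lim (fst @ F), lim (snd @ F)) : V).
apply/cvgrPdist_lt => e e0.
have e2 : 0 < e / 2 by rewrite divr_gt0.
move/cvgrPdist_lt: c1 => /(_ _ e2) n1; move/cvgrPdist_lt: c2 => /(_ _ e2) n2.
near=> p; rewrite (splitr e).
apply: le_lt_trans (hsum_norm_le _) _; apply: ltrD; rewrite /=.
  by near: p; exact: n1.
by near: p; exact: n2.
Unshelve. all: by end_near. Qed.

HB.instance Definition _ := Uniform_isComplete.Build V hsum_complete.

Definition hsum_dot (p q : V) : C := hdot p.1 q.1 + hdot p.2 q.2.

Lemma hsum_dot_bilinear :
  bilinear_for ( *%R : C -> C -> C) (Num.conj \; *%R : C -> C -> C) hsum_dot.
Proof.
split=> [u a x y|u a x y]; rewrite /hsum_dot/=.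
  by rewrite !linearPl/= mulrDr addrACA.
by rewrite !linearPr/= mulrDr addrACA.
Qed.

HB.instance Definition _ :=
  @bilinear_isBilinear.Build C V V C *%R (Num.conj \; *%R)
    hsum_dot hsum_dot_bilinear.

Lemma hsum_dot_herm (p q : V) :
  hsum_dot p q = (-1) ^+ false * Num.conj (hsum_dot q p).
Proof.
by rewrite /hsum_dot rmorphD/= mulrDr; congr (_ + _); apply: hermC.
Qed.

HB.instance Definition _ :=
  isHermitianSesquilinear.Build C V false Num.conj hsum_dot hsum_dot_herm.

Lemma hsum_dotE (p : V) : `|p| ^+ 2 = hsum_dot p p.
Proof. by rewrite sqr_hsum_norm !sqr_hnormE. Qed.

Lemma hsum_dot_gt0 (p : V) : p != 0 -> 0 < hsum_dot p p.
Proof. by move=> p0; rewrite -hsum_dotE exprn_gt0// normr_gt0. Qed.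

HB.instance Definition _ :=
  isDotProduct.Build C V hsum_dot hsum_dot_gt0.

HB.instance Definition _ :=
  NormedModule_isHilbert.Build R V hsum_dotE.

End HilbertSum.

Section LinearRelations.
Context {R : realType}.
Implicit Types H K L X : hilbertType R.

Definition lin_subspace H (W : set H) : Prop :=
  GRing.submod_closed (mem W).

Definition CR H K : set (set (hsum H K)) :=
  [set T | lin_subspace T /\ closed T].

Definition rdom H K (T : set (hsum H K)) : set H :=
  [set x | exists y, T (x, y)].

Definition rran H K (T : set (hsum H K)) : set K :=
  [set y | exists x, T (x, y)].

Definition rker H K (T : set (hsum H K)) : set H := [set x | T (x, 0)].

Definition rinv H K (T : set (hsum H K)) : set (hsum K H) :=
  [set p | T (p.2, p.1)].

(** The product [T S] ([S] is applied first). *)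
Definition rmul H K L (T : set (hsum K L)) (S : set (hsum H K)) :
    set (hsum H L) :=
  [set p | exists z, S (p.1, z) /\ T (z, p.2)].

Definition orthoc H (W : set H) : set H :=
  [set x | forall w, W w -> hdot x w = 0].

(** The orthogonal projection onto [W], identified with its graph. *)
Definition rproj H (W : set H) : set (hsum H H) :=
  [set p | W p.2 /\ orthoc W (p.1 - p.2)].

(** The Moore-Penrose inverse [P_(N(T)^perp) T^-1 P_R(T)].  Since [rproj W] has
    domain [W + W^perp], this relation has domain [R(T) + R(T)^perp]. *)
Definition rpinv H K (T : set (hsum H K)) : set (hsum K H) :=
  rmul (rproj (orthoc (rker T))) (rmul (rinv T) (rproj (rran T))).

Definition rshift X (S : set (hsum X X)) (l : R[i]) : set (hsum X X) :=
  [set ((p.1, p.2 - l *: p.1) : hsum X X) | p in S].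

Definition fin_dim H (W : set H) : Prop :=
  exists n (v : 'I_n -> H),
    W = range (fun c : 'I_n -> R[i] => \sum_i c i *: v i).

(** The quotient of [H] by the subspace [W] is finite-dimensional: it is
    spanned by the classes of finitely many vectors. *)
Definition fin_codim H (W : set H) : Prop :=
  exists n (v : 'I_n -> H),
    forall x, exists c : 'I_n -> R[i], W (x - \sum_i c i *: v i).

Definition phi_plus H K : set (set (hsum H K)) :=
  [set T | [/\ CR T, closed (rran T) & fin_dim (rker T)]].

Definition phi_minus H K : set (set (hsum H K)) :=
  [set T | [/\ CR T, closed (rran T) & fin_codim (rran T)]].

Definition sigma_e1 X (S : set (hsum X X)) : set R[i] :=
  [set l | ~ @phi_plus X X (rshift S l)].

Definition sigma_e2 X (S : set (hsum X X)) : set R[i] :=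
  [set l | ~ @phi_minus X X (rshift S l)].

Definition sigma_e3 X (S : set (hsum X X)) : set R[i] :=
  [set l | ~ (@phi_plus X X `|` @phi_minus X X) (rshift S l)].

Definition sigma_e4 X (S : set (hsum X X)) : set R[i] :=
  [set l | ~ (@phi_plus X X `&` @phi_minus X X) (rshift S l)].

(** The block relation with zero diagonal blocks, upper right block [B] and
    lower left block [T]. *)
Definition roffdiag H K (B : set (hsum K H)) (T : set (hsum H K)) :
    set (hsum (hsum H K) (hsum H K)) :=
  [set p | B (p.1.2, p.2.1) /\ T (p.1.1, p.2.2)].

End LinearRelations.

(* Main.v *)
From HB Require Import structures.
Require Import Defs.
From mathcomp Require Import all_boot all_order all_algebra complex.
From mathcomp Require Import all_classical all_reals all_analysis.
From mathcomp Require Import ring lra.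
Import Order.TTheory GRing.Theory Num.Theory.
Import numFieldNormedType.Exports.
Local Open Scope classical_set_scope.
Local Open Scope ring_scope.
Local Open Scope complex_scope.

(** The three relations can be put in closed form.  Let [P] be the orthogonal
    projection onto [R(T)] and [Q] the one onto the orthogonal complement of
    [N(T)].  The Moore-Penrose inverse is the graph of a linear operator
    [S : K -> H], where [S y] is the only point of [R(Q)] that [T] relates to
    [P y] ([moore_penrose_operator]).  Writing [M] for the multivalued part
    [T(0)], it follows that the product [T^+ T] is the operator [Q] and that
    [T T^+] is [P] up to [M]: it consists of the pairs [(y, z)] such that
    [z - P y] is in [M] ([TdTE], [TTdE]).

    Since [P] and [Q] are idempotent and [M] is contained in [R(P)], the
    ranges of [T^+ T - m], [T T^+ - m] and [A - l] are always closed: when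
    [m], or [l^2], is neither [0] nor [1] they are the whole space, and in the
    exceptional cases they are preimages of closed subspaces under continuous
    maps ([closed_ran_TTd], [closed_ran_TdT], [closed_ran_offdiag]).  So
    membership in [phi_+] reduces to the finite dimension of a kernel, and
    membership in [phi_-] to the finite codimension of a range.

    For [l = 0] the kernel and the range of [A] are the products of those of
    [T^+ T] and [T T^+].  For [l != 0] elimination of the first coordinate
    identifies the kernel of [A - l] with that of [T T^+ - l^2], by
    [y |-> (S y / l, y)], and the quotient by the range of [A - l] with the
    quotient by the range of [T T^+ - l^2], by [k |-> (0, k / l)].  Moreover
    [S] maps the kernel of [T T^+ - m] onto that of [T^+ T - m] and induces a
    surjection between the quotients by the ranges when [m != 0], so the
    conditions on [T^+ T - l^2] follow from those on [T T^+ - l^2].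
    Altogether [A - l] is in [phi_+] (resp. [phi_-]) if and only if both
    [T T^+ - l^2] and [T^+ T - l^2] are ([phi_plus_offdiag],
    [phi_minus_offdiag]), and the four spectral identities are propositional
    consequences of these two equivalences; the mixed terms of the third one
    come from distributing a disjunction over two conjunctions. *)

Set Implicit Arguments.
Unset Strict Implicit.
Unset Printing Implicit Defensive.

(** * Linear subspaces *)

Section Subspace.
Context {R : realType} {H : hilbertType R} {W : set H}.
Hypothesis WS : lin_subspace W.

Lemma subspace_lin a u v : W u -> W v -> W (a *: u + v).
Proof. by move=> Wu Wv; apply/set_mem/(WS.2 a); apply/mem_set. Qed.

Lemma subspace0 : W 0.
Proof. exact/set_mem/WS.1. Qed.

Lemma subspaceD u v : W u -> W v -> W (u + v).
Proof. by rewrite -[u in W (u + v)]scale1r; exact: subspace_lin. Qed.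

Lemma subspaceZ a u : W u -> W (a *: u).
Proof. by move=> Wu; rewrite -[_ *: _]addr0; apply: subspace_lin subspace0. Qed.

Lemma subspaceB u v : W u -> W v -> W (u - v).
Proof. by move=> Wu Wv; rewrite addrC -scaleN1r; exact: subspace_lin. Qed.

Lemma subspace_sum n (v : 'I_n -> H) :
  (forall i, W (v i)) -> W (\sum_i v i).
Proof.
by move=> Wv; apply: (big_ind W) => //; [exact: subspace0|exact: subspaceD].
Qed.
End Subspace.

(** * The orthogonal projection onto a closed subspace *)

Section Projection.
Context {R : realType} {H : hilbertType R}.
Local Notation C := R[i].
Implicit Types x y u w : H.

(** Norms and inner products take their values in the partially ordered field
    [R[i]]; this real-valued square of the norm is what infima and linear
    arithmetic apply to. *)
Definition sqn x : R := complex.Re (hdot x x).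

Lemma hdot_sqn x : hdot x x = (sqn x)%:C.
Proof. by rewrite RRe_real// ger0_real// dnorm_ge0. Qed.

Lemma sqn_ge0 x : 0 <= sqn x.
Proof. by rewrite -ler0c -hdot_sqn dnorm_ge0. Qed.

Lemma sqr_norm_sqn x : `|x| ^+ 2 = (sqn x)%:C.
Proof. by rewrite sqr_hnormE hdot_sqn. Qed.

Lemma norm_lt_sqn x (r : R) : 0 <= r -> (`|x| < r%:C) = (sqn x < r ^+ 2).
Proof.
move=> r0; rewrite -(@ltr_pXn2r _ 2)// ?qualifE/= ?ler0c//.
by rewrite sqr_norm_sqn -rmorphXn/= ltcR.
Qed.

Lemma sqnZ (c : C) x : (sqn (c *: x))%:C = `|c| ^+ 2 * (sqn x)%:C.
Proof. by rewrite -!hdot_sqn dnormZ. Qed.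

Lemma parallelogram u v :
  sqn (u + v) + sqn (u - v) = 2 * sqn u + 2 * sqn v.
Proof.
apply: complexI; rewrite !(rmorphD, rmorphM)/= -!hdot_sqn dnormD dnormB.
rewrite !rmorph1; ring.
Qed.

(** The comparison point [c = s (u, w)] with the real factor
    [s = 1 / (|w|^2 + 1)] avoids a case distinction on [w = 0]: it turns
    minimality into [(s + s^2) |(u, w)|^2 <= 0]. *)
Lemma nearest_orthogonal u w :
  (forall c : C, sqn u <= sqn (u - c *: w)) -> hdot u w = 0.
Proof.
move=> umin; set t := hdot u w.
pose s : C := (sqn w + 1)^-1%:C.
have s0 : 0 < s by rewrite ltcR invr_gt0 ltr_wpDl ?sqn_ge0.
have sJ : Num.conj s = s by apply/CrealP/ger0_real/ltW.
have sw : s * (sqn w)%:C = 1 - s.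
  rewrite -(rmorph1 (real_complex R)) -rmorphB -rmorphM; congr (_%:C).
  by field; rewrite gt_eqF// ltr_wpDl ?sqn_ge0.
have dE : hdot u ((s * t) *: w) = s * `|t| ^+ 2.
  by rewrite linearZr_LR/= rmorphM/= sJ -/t normCK; ring.
have dJ : Num.conj (s * `|t| ^+ 2) = s * `|t| ^+ 2.
  by apply/CrealP/ger0_real/mulr_ge0; rewrite ?exprn_ge0// ltW.
have := umin (s * t); rewrite -lecR -!hdot_sqn dnormB dnormZ dE dJ.
rewrite normrM exprMn (ger0_norm (ltW s0)) (hdot_sqn w).
have -> : s ^+ 2 * `|t| ^+ 2 * (sqn w)%:C =
    s * `|t| ^+ 2 * (s * (sqn w)%:C) by ring.
rewrite sw -subr_ge0.
have -> : hdot u u + s * `|t| ^+ 2 * (1 - s) -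
    (s * `|t| ^+ 2 + s * `|t| ^+ 2) - hdot u u =
  - ((s + s ^+ 2) * `|t| ^+ 2) by ring.
rewrite oppr_ge0 pmulr_rle0 ?addr_gt0 ?exprn_gt0// => t0.
by apply/eqP; rewrite -normr_eq0 -sqrf_eq0 eq_le t0 exprn_ge0.
Qed.

Section Nearest.
Variables (W : set H) (x : H).
Hypotheses (WS : lin_subspace W) (Wc : closed W).

Let d := inf [set sqn (x - w) | w in W].

Lemma sqn_ge_dist w : W w -> d <= sqn (x - w).
Proof.
move=> Ww; apply: ge_inf; last by exists w.
by exists 0 => _ [v _ <-]; exact: sqn_ge0.
Qed.

(** The midpoint of [w] and [v] is in [W], hence at squared distance at least
    [d] from [x], and the parallelogram identity bounds [w - v]. *)
Lemma minimizers_close w v (e : R) : W w -> W v ->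
  sqn (x - w) < d + e -> sqn (x - v) < d + e -> sqn (w - v) < 4 * e.
Proof.
move=> Ww Wv lw lv; have := parallelogram (x - v) (x - w).
have -> : x - v - (x - w) = w - v.
  by rewrite opprB addrC addrA subrK.
have -> : x - v + (x - w) = (2 : C) *: (x - (2^-1 : C) *: (w + v)).
  by rewrite scalerBr scalerA mulfV ?pnatr_eq0// scale1r scaler_nat mulr2n
    addrACA -opprD (addrC v).
have /sqn_ge_dist : W ((2^-1 : C) *: (w + v)).
  by apply: subspaceZ => //; exact: subspaceD.
set m := x - _ => dm.
have -> : sqn ((2 : C) *: m) = 4 * sqn m.
  apply: complexI; rewrite sqnZ rmorphM/= normr_nat -natrX.
  by rewrite (rmorph_nat (real_complex R)).
by lra.
Qed.

(** The filter of approximate minimizers: it plays the role of a minimizing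
    sequence, and [minimizers_close] says that it is Cauchy. *)
Let F : set_system H :=
  filter_from [set e : R | 0 < e]
    (fun e => [set w | W w /\ sqn (x - w) < d + e]).

Lemma nearest_exists : exists2 p, W p & sqn (x - p) <= d.
Proof.
have hasE : has_inf [set sqn (x - w) | w in W].
  split; first by exists (sqn (x - 0)), 0 => //; exact: (subspace0 WS).
  by exists 0 => _ [v _ <-]; exact: sqn_ge0.
have FF : ProperFilter F.
  apply: filter_from_proper; last first.
    move=> e e0; have [_ [w Ww <-] lw] := inf_adherent e0 hasE.
    by exists w.
  apply: filter_from_filter; first by exists 1 => /=.
  move=> e e' e0 e'0; exists (Num.min e e') => /=; first by rewrite lt_min e0.
  move=> w [Ww]; rewrite -ltrBlDl lt_min !ltrBlDl => /andP[le le'].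
  by split; split.
have real_radius (e : C) : 0 < e -> exists2 r : R, 0 < r & r%:C = e.
  move=> e0; have eR : (complex.Re e)%:C = e by rewrite RRe_real ?gtr0_real.
  by exists (complex.Re e) => //; rewrite -ltcR eR.
have : cvg F.
  apply: cauchy_cvg; apply/cauchy_ballP => _ /real_radius[r r0 <-].
  exists ([set w | W w /\ sqn (x - w) < d + r ^+ 2 / 4],
          [set w | W w /\ sqn (x - w) < d + r ^+ 2 / 4]) => /=.
    by split; exists (r ^+ 2 / 4) => //=; rewrite divr_gt0 ?exprn_gt0.
  move=> -[w v] /= [[Ww lw] [Wv lv]].
  rewrite -ball_normE/= norm_lt_sqn ?ltW//.
  by have := minimizers_close Ww Wv lw lv; lra.
move/cvg_ex => [p Fp]; exists p.
  apply: Wc => B /Fp FB.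
  have /filter_ex [w [[Ww _] Bw]] :
    F ([set w | W w /\ sqn (x - w) < d + 1] `&` B).
    by apply: filterI => //; exists 1 => //=.
  by exists w.
have d0 : 0 <= d by apply: lb_le_inf hasE.1 _ => _ [v _ <-]; exact: sqn_ge0.
(* Otherwise [N = |x - p|] exceeds [D], the square root of [d]; a point [w]
   within [r = (N - D) / 2] of [p] and with [|x - w|^2 < d + r^2], which is at
   most [(D + r)^2], gives [N < D + 2 r = N]. *)
rewrite leNgt; apply/negP => dp.
pose N := Num.sqrt (sqn (x - p)); pose D := Num.sqrt d.
have N2 : N ^+ 2 = sqn (x - p) by rewrite sqr_sqrtr// sqn_ge0.
have D2 : D ^+ 2 = d by rewrite sqr_sqrtr.
have N0 : 0 <= N := sqrtr_ge0 _.
have D0 : 0 <= D := sqrtr_ge0 _.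
have DN : D < N by rewrite ltr_sqrt ?(le_lt_trans d0).
pose r := (N - D) / 2.
have r0 : 0 < r by rewrite /r; lra.
have /filter_ex [w [/= pw [Ww xw]]] : F (ball p r%:C `&`
    [set w | W w /\ sqn (x - w) < d + r ^+ 2]).
  apply: filterI; last by exists (r ^+ 2) => //=; rewrite exprn_gt0.
  by apply: Fp; apply: nbhsx_ballx; rewrite ltcR.
have : `|x - p| < (N)%:C.
  rewrite (_ : N = (D + r) + r); last by rewrite /r; lra.
  rewrite rmorphD/= -(subrKA w) (le_lt_trans (ler_normD _ _))// ltrD//.
    rewrite norm_lt_sqn ?addr_ge0 ?(ltW r0)// (lt_le_trans xw)//.
    by rewrite sqrrD D2 addrAC lerDl mulrn_wge0// mulr_ge0// ltW.
  by rewrite distrC; move: pw; rewrite -ball_normE.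
by rewrite norm_lt_sqn// N2 ltxx.
Qed.

Lemma projection_point : exists2 p, W p & orthoc W (x - p).
Proof.
have [p Wp xp] := nearest_exists; exists p => // w Ww.
apply: nearest_orthogonal => c; apply: le_trans xp _.
rewrite -addrA -opprD; apply: sqn_ge_dist.
by apply: subspaceD => //; exact: subspaceZ.
Qed.
End Nearest.

Lemma orthoc_disjoint (W : set H) x : W x -> orthoc W x -> x = 0.
Proof. by move=> Wx /(_ _ Wx)/eqP; rewrite dnorm_eq0 => /eqP. Qed.

Lemma orthoc_subspace (W : set H) : lin_subspace (orthoc W).
Proof.
split; first by apply/mem_set => w _; rewrite linear0l.
move=> a u v /set_mem Ou /set_mem Ov; apply/mem_set => w Ww.
by rewrite linearPl/= Ou// Ov// mulr0 addr0.
Qed.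

Lemma projection_unique (W : set H) x p q : lin_subspace W ->
  W p -> orthoc W (x - p) -> W q -> orthoc W (x - q) -> p = q.
Proof.
move=> WS Wp Op Wq Oq; apply/eqP; rewrite -subr_eq0; apply/eqP.
apply: (@orthoc_disjoint W); first exact: subspaceB.
rewrite (_ : p - q = (x - q) - (x - p)); last first.
  by rewrite opprB [RHS]addrC subrKA.
exact: (subspaceB (@orthoc_subspace W)).
Qed.

Theorem orthogonal_projection (W : set H) : lin_subspace W -> closed W ->
  exists P : {linear H -> H},
    [/\ continuous P, forall x, W (P x) & forall x, orthoc W (x - P x)].
Proof.
move=> WS Wc.
have /choice[P PP] x : exists p, W p /\ orthoc W (x - p).
  by have [p] := projection_point x WS Wc; exists p.
have Plin : linear P.
  move=> a x y; have [Wx Ox] := PP x; have [Wy Oy] := PP y.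
  have [Wxy Oxy] := PP (a *: x + y).
  apply: (projection_unique WS Wxy Oxy); first exact: subspace_lin.
  rewrite opprD addrACA -scalerBr; exact: (subspace_lin (@orthoc_subspace W)).
pose mix := GRing.isLinear.Build C H H *:%R P Plin.
pose L : {linear H -> H} := HB.pack P mix.
exists L; split=> [|x|x]; [|exact: (PP x).1|exact: (PP x).2].
apply/bounded_linear_continuous/bounded_funP => r; exists r => x.
apply: le_trans.
rewrite -(@ler_pXn2r _ 2)// ?qualifE/= ?normr_ge0// !sqr_hnormE.
have xE : x = x - P x + P x by rewrite subrK.
rewrite [in leRHS]xE hnormDd ?lerDr ?dnorm_ge0//.
exact/(PP x).2/(PP x).1.
Qed.
End Projection.

(** * Closed subspaces and continuity on the Hilbert sum *)

Section ClosedSubspaces.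
Context {R : realType}.
Local Notation C := R[i].
Implicit Types H K X Y : hilbertType R.

(** On a Hilbert sum this is, by definition, membership in [CR]; the lemmas on
    closed subspaces therefore apply to closed linear relations as they are. *)
Definition closed_subspace X (W : set X) := lin_subspace W /\ closed W.

Lemma closed_subspace_preimage X Y (f : X -> Y) (W : set Y) :
  linear f -> continuous f -> closed_subspace W -> closed_subspace (f @^-1` W).
Proof.
move=> flin fc [WS Wc]; split; last by move/continuous_closedP: fc; exact.
pose mix := GRing.isLinear.Build C X Y *:%R f flin.
pose F : {linear X -> Y} := HB.pack f mix.
have f0 : f 0 = 0 := linear0 F.
split; first by apply/mem_set; rewrite /preimage/= f0; exact: subspace0.
move=> a u v /set_mem Wu /set_mem Wv; apply/mem_set; rewrite /preimage/= flin.
exact: subspace_lin.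
Qed.

Lemma closed_subspaceI X (V W : set X) :
  closed_subspace V -> closed_subspace W -> closed_subspace (V `&` W).
Proof.
move=> [VS Vc] [WS Wc]; split; last exact: closedI.
split; first by apply/mem_set; split; exact: subspace0.
move=> a u v /set_mem[Vu Wu] /set_mem[Vv Wv].
by apply/mem_set; split; exact: subspace_lin.
Qed.

Lemma closed_subspace0 X : closed_subspace [set (0 : X)].
Proof.
split; last exact/accessible_closed_set1/hausdorff_accessible/norm_hausdorff.
split; first exact/mem_set.
by move=> a u v /set_mem-> /set_mem->; apply/mem_set; rewrite /= scaler0 addr0.
Qed.

Lemma closed_subspace_ker X Y (f : X -> Y) :
  linear f -> continuous f -> closed_subspace [set x | f x = 0].
Proof.
by move=> fl fc; exact: (closed_subspace_preimage fl fc (closed_subspace0 Y)).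
Qed.

Lemma nonexpansive_continuous X Y (f : X -> Y) :
  (forall x y, `|f x - f y| <= `|x - y|) -> continuous f.
Proof.
move=> fl x; apply/(@cvgrPdist_lt _ _ _ (nbhs x)) => e e0.
near=> y; apply: le_lt_trans (fl _ _) _.
by near: y; apply: cvgr_dist_lt.
Unshelve. all: by end_near. Qed.

Lemma hsum_fst_continuous H K : continuous (fun p : hsum H K => p.1).
Proof.
apply: (@nonexpansive_continuous (hsum H K) H) => p q.
exact: hsum_norm_fst (p - q).
Qed.

Lemma hsum_snd_continuous H K : continuous (fun p : hsum H K => p.2).
Proof.
apply: (@nonexpansive_continuous (hsum H K) K) => p q.
exact: hsum_norm_snd (p - q).
Qed.

Lemma hsum_pair_continuous (X : topologicalType) H K (f : X -> H) (g : X -> K) :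
  continuous f -> continuous g -> continuous (fun x => (f x, g x) : hsum H K).
Proof.
move=> fc gc x; apply/(@cvgrPdist_lt _ _ _ (nbhs x)) => e e0.
have e2 : 0 < e / 2 by rewrite divr_gt0.
near=> y; rewrite (splitr e).
apply: le_lt_trans (hsum_norm_le _) _; apply: ltrD => /=.
  by near: y; apply: cvgr_dist_lt => //; exact: fc.
by near: y; apply: cvgr_dist_lt => //; exact: gc.
Unshelve. all: by end_near. Qed.

Lemma continuousDZ (X : topologicalType) H (f g : X -> H) (l : C) :
  continuous f -> continuous g -> continuous (fun x => f x + l *: g x).
Proof.
by move=> fc gc x; apply: cvgD; [exact: fc|apply: cvgZr; exact: gc].
Qed.

Lemma continuous_comp_fun (X Y Z : topologicalType) (f : X -> Y) (g : Y -> Z) :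
  continuous f -> continuous g -> continuous (fun x => g (f x)).
Proof. by move=> fc gc x; apply: continuous_comp; [exact: fc|exact: gc]. Qed.

Lemma closed_subspace_fixed X (E : {linear X -> X}) :
  continuous E -> closed_subspace [set x | E x = x].
Proof.
move=> Ec; have -> : [set x | E x = x] = [set x | x + (-1) *: E x = 0].
  apply/seteqP; split=> x /=; rewrite scaleN1r; first by move->; rewrite subrr.
  by move=> /eqP; rewrite subr_eq0 => /eqP.
apply: (@closed_subspace_ker X X (fun x => x + (-1) *: E x)).
  by move=> a x y; rewrite linearP !scaleN1r opprD scalerBr addrACA.
by apply: continuousDZ => // x; exact: cvg_id.
Qed.

Lemma CR_graph X Y (f : {linear X -> Y}) :
  continuous f -> CR [set p : hsum X Y | p.2 = f p.1].
Proof.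
move=> fc.
have -> : [set p : hsum X Y | p.2 = f p.1] =
    [set p : hsum X Y | p.2 + (-1) *: f p.1 = 0].
  apply/seteqP; split=> -[x y] /=; rewrite scaleN1r.
    by move->; rewrite subrr.
  by move=> /eqP; rewrite subr_eq0 => /eqP.
apply: (@closed_subspace_ker (hsum X Y) Y (fun p => p.2 + (-1) *: f p.1)).
  move=> a [x y] [x' y'] /=.
  by rewrite linearP !scaleN1r opprD scalerBr addrACA.
apply: (@continuousDZ (hsum X Y)); first exact: hsum_snd_continuous.
exact: (continuous_comp_fun (@hsum_fst_continuous X Y) fc).
Qed.

Lemma rshiftE X (S : set (hsum X X)) (l : C) :
  Defs.rshift S l = [set p | S (p.1, p.2 + l *: p.1)].
Proof.
apply/seteqP; split=> [_ [[x y] Sxy <-]|[x y] Sxy] /=; first by rewrite subrK.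
by exists (x, y + l *: x); rewrite //= addrK.
Qed.

Lemma CR_rshift X (S : set (hsum X X)) (l : C) : CR S -> CR (Defs.rshift S l).
Proof.
move=> SC; rewrite rshiftE.
apply: (closed_subspace_preimage (f := fun p : hsum X X =>
  (p.1, p.2 + l *: p.1) : hsum X X) _ _ SC).
  move=> a [x y] [x' y']; congr pair => /=.
  by rewrite !scalerDr !scalerA (mulrC l) addrACA.
apply: hsum_pair_continuous; first exact: hsum_fst_continuous.
apply: (@continuousDZ (hsum X X)); first exact: hsum_snd_continuous.
exact: hsum_fst_continuous.
Qed.
End ClosedSubspaces.

(** * Finite dimension and finite codimension *)

Section FiniteDimension.
Context {R : realType}.
Local Notation C := R[i].
Implicit Types H K X Y : hilbertType R.

Lemma fin_dim_image X Y (f : X -> Y) (W : set X) :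
  linear f -> fin_dim W -> fin_dim (f @` W).
Proof.
move=> flin [n [v ->]]; exists n, (f \o v).
pose mix := GRing.isLinear.Build C X Y *:%R f flin.
pose F : {linear X -> Y} := HB.pack f mix.
have fE c : f (\sum_i c i *: v i) = \sum_i c i *: f (v i).
  rewrite -[f]/(F : X -> Y) linear_sum.
  by apply: eq_bigr => i _; rewrite linearZ.
apply/seteqP; split=> [_ [_ [c _ <-] <-]|_ [c _ <-]].
  by exists c; rewrite // fE.
by exists (\sum_i c i *: v i); [exists c|rewrite fE].
Qed.

Let cat_ord T m n (a : 'I_m -> T) (b : 'I_n -> T) (i : 'I_(m + n)) : T :=
  match fintype.split i with inl j => a j | inr k => b k end.

Let sum_cat_ord (X : lmodType C) m n (c : 'I_(m + n) -> C)
    (a : 'I_m -> X) (b : 'I_n -> X) :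
  \sum_i c i *: cat_ord a b i =
  \sum_i c (lshift n i) *: a i + \sum_i c (rshift m i) *: b i.
Proof.
rewrite big_split_ord /cat_ord; congr (_ + _); apply: eq_bigr => i _.
  by rewrite (unsplitK (inl i)).
by rewrite (unsplitK (inr i)).
Qed.

Lemma hsum_sum H K n (v : 'I_n -> hsum H K) :
  \sum_i v i = (\sum_i (v i).1, \sum_i (v i).2) :> hsum H K.
Proof.
by elim/big_rec3: _ => // i x y [? ?] _ [-> ->].
Qed.

Let sum_hsum_split H K m n (c : 'I_(m + n) -> C)
    (a : 'I_m -> H) (b : 'I_n -> K) :
  \sum_i c i *: cat_ord (fun j => (a j, 0)) (fun k => (0, b k)) i =
  (\sum_i c (lshift n i) *: a i, \sum_i c (rshift m i) *: b i) :> hsum H K.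
Proof.
rewrite sum_cat_ord !hsum_sum; congr pair => /=.
  by rewrite [X in _ + X]big1 ?addr0// => i _; rewrite scaler0.
by rewrite [X in X + _]big1 ?add0r// => i _; rewrite scaler0.
Qed.

Let cat_ordl T m n (a : 'I_m -> T) (b : 'I_n -> T) i :
  cat_ord a b (lshift n i) = a i.
Proof. by rewrite /cat_ord (unsplitK (inl i)). Qed.

Let cat_ordr T m n (a : 'I_m -> T) (b : 'I_n -> T) i :
  cat_ord a b (rshift m i) = b i.
Proof. by rewrite /cat_ord (unsplitK (inr i)). Qed.

Lemma fin_dim_prod H K (V : set H) (W : set K) :
  fin_dim V -> fin_dim W -> fin_dim (V `*` W : set (hsum H K)).
Proof.
move=> [m [a ->]] [n [b ->]].
exists (m + n)%N, (cat_ord (fun j => (a j, 0)) (fun k => (0, b k))).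
apply/seteqP; split=> [[x y] [/= [c _ <-] [d _ <-]]|_ [c _ <-]].
  exists (cat_ord c d); rewrite // sum_hsum_split.
  by congr pair; apply: eq_bigr => i _; rewrite ?cat_ordl ?cat_ordr.
rewrite sum_hsum_split.
by split; [exists (c \o @lshift m n)|exists (c \o @rshift m n)].
Qed.

Lemma fin_codim_prod H K (V : set H) (W : set K) :
  fin_codim V -> fin_codim W -> fin_codim (V `*` W : set (hsum H K)).
Proof.
move=> [m [a aV]] [n [b bW]].
exists (m + n)%N, (cat_ord (fun j => (a j, 0)) (fun k => (0, b k))) => -[x y].
have [c Vc] := aV x; have [d Wd] := bW y.
exists (cat_ord c d); rewrite sum_hsum_split; split => /=.
  by rewrite (eq_bigr (fun i => c i *: a i))// => i _; rewrite cat_ordl.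
by rewrite (eq_bigr (fun i => d i *: b i))// => i _; rewrite cat_ordr.
Qed.

(** For a subspace [V], a linear relation [G] defined everywhere and mapping
    [V] into [W] induces a linear map between the quotients; it is onto as soon
    as [R(G)] meets every class modulo [W].  Relations rather than maps are
    used because a relation like [T] comes without a linear selection. *)
Lemma fin_codim_transfer X Y (G : set (hsum X Y)) (V : set X) (W : set Y) :
  lin_subspace G -> lin_subspace W -> rdom G = setT ->
  (forall x y, G (x, y) -> V x -> W y) ->
  (forall y, exists2 y', rran G y' & W (y - y')) ->
  fin_codim V -> fin_codim W.
Proof.
move=> GS WS Gdom GVW Gran [n [v vV]].
have /choice[w Gvw] i : exists y, G (v i, y).
  by have : rdom G (v i) by rewrite Gdom.
exists n, w => y; have [y' [x Gxy'] Wy] := Gran y; have [c Vc] := vV x.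
exists c; rewrite -(subrKA y'); apply: subspaceD => //.
apply: GVW Vc; apply: (subspaceB GS Gxy' (v := (_, _))).
have -> : (\sum_i c i *: v i, \sum_i c i *: w i) =
    \sum_i c i *: (v i, w i) :> hsum X Y by rewrite hsum_sum.
by apply: (subspace_sum GS) => i; exact: (subspaceZ GS).
Qed.
End FiniteDimension.

Lemma fin_codim_map (R : realType) (X Y : hilbertType R) (f : X -> Y)
    (V : set X) (W : set Y) :
  linear f -> lin_subspace W -> (forall x, V x -> W (f x)) ->
  (forall y, exists x, W (y - f x)) -> fin_codim V -> fin_codim W.
Proof.
move=> fl WS fVW fsurj.
apply: (@fin_codim_transfer _ _ _ [set p : hsum X Y | p.2 = f p.1]) => //.
- pose mix := GRing.isLinear.Build R[i] X Y *:%R f fl.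
  pose F : {linear X -> Y} := HB.pack f mix.
  split; first by apply/mem_set; rewrite /= -[f]/(F : X -> Y) linear0.
  move=> a [x y] [x' y'] /set_mem/= -> /set_mem/= ->; apply/mem_set.
  by rewrite /= fl.
- by apply/seteqP; split=> // x _; exists (f x).
- by move=> x y /= -> /fVW.
- by move=> y; have [x Wx] := fsurj y; exists (f x) => //; exists x.
Qed.

Lemma lin_subspace_rran (R : realType) (X Y : hilbertType R)
  (T : set (hsum X Y)) : lin_subspace T -> lin_subspace (rran T).
Proof.
move=> TS; split; first by apply/mem_set; exists 0; exact: (subspace0 TS).
move=> a y y' /set_mem[x Txy] /set_mem[x' Txy']; apply/mem_set.
by exists (a *: x + x'); exact: (subspace_lin TS a Txy Txy').
Qed.

(** The spectrum of an idempotent [E] is contained in [{0, 1}]: for the other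
    [m], the inverse of [E - m] is [E / (m (1 - m)) - 1 / m]. *)
Lemma idempotent_shift_surj (R : realType) (X : hilbertType R)
    (E : {linear X -> X}) (m : R[i]) (w : X) :
  (forall x, E (E x) = E x) -> m != 0 -> m != 1 -> exists y, w + m *: y = E y.
Proof.
move=> EE m0 m1; have m1' : 1 - m != 0 by rewrite subr_eq0 eq_sym.
exists ((m * (1 - m))^-1 *: E w - m^-1 *: w).
rewrite [RHS]linearB [E (_ *: E _)]linearZ [E (_ *: w)]linearZ/= EE.
rewrite scalerBr !scalerA divff// scale1r.
rewrite addrC subrK -scalerBl; congr (_ *: _).
by field; rewrite m0 m1'.
Qed.

Lemma lin_subspace_rker (R : realType) (X Y : hilbertType R)
  (T : set (hsum X Y)) : lin_subspace T -> lin_subspace (rker T).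
Proof.
move=> TS; split; first by apply/mem_set; exact: (subspace0 TS).
move=> a x x' /set_mem Tx /set_mem Tx'; apply/mem_set.
have := subspace_lin TS a Tx Tx'.
by rewrite /rker/= -[X in T X]/(_, a *: 0 + 0) scaler0 addr0.
Qed.

Section Products.
Context {R : realType} {H K : hilbertType R} (V : set H) (W : set K).
Hypotheses (VS : lin_subspace V) (WS : lin_subspace W).

Lemma fin_dim_prodP :
  fin_dim (V `*` W : set (hsum H K)) <-> fin_dim V /\ fin_dim W.
Proof.
split=> [fVW|[]]; last exact: fin_dim_prod; split.
  have -> : V = (fun p : hsum H K => p.1) @` (V `*` W).
    apply/seteqP; split=> [x Vx|_ [p [Vp _] <-]//].
    by exists (x, 0) => //; split=> //; exact: subspace0.
  exact: (@fin_dim_image _ (hsum H K) H).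
have -> : W = (fun p : hsum H K => p.2) @` (V `*` W).
  apply/seteqP; split=> [y Wy|_ [p [_ Wp] <-]//].
  by exists (0, y) => //; split=> //; exact: subspace0.
exact: (@fin_dim_image _ (hsum H K) K).
Qed.

Lemma fin_codim_prodP :
  fin_codim (V `*` W : set (hsum H K)) <-> fin_codim V /\ fin_codim W.
Proof.
split=> [fVW|[]]; last exact: fin_codim_prod; split.
  apply: (@fin_codim_map _ (hsum H K) H (fun p => p.1) (V `*` W)
    _ _ _ _ _ fVW) => //.
    by move=> p [].
  by move=> x; exists (x, 0); rewrite /= subrr; exact: subspace0.
apply: (@fin_codim_map _ (hsum H K) K (fun p => p.2) (V `*` W)
    _ _ _ _ _ fVW) => //.
  by move=> p [].
by move=> x; exists (0, x); rewrite /= subrr; exact: subspace0.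
Qed.
End Products.

(** * The block relation, in terms of the operators [P], [Q] and [S] *)

(** [T] is known here only through three operators: [P] projects onto its
    range, [Q] along its kernel, and [S] is its Moore-Penrose inverse. *)
Section Blocks.
Context {R : realType} {H K : hilbertType R}.
Local Notation C := R[i].
Variables (T : set (hsum H K)).
Variables (P : {linear K -> K}) (Q : {linear H -> H}) (S : {linear K -> H}).
Hypotheses (T_CR : CR T) (T_dom : rdom T = [set: H]).
Hypotheses (T_SP : forall y, T (S y, P y)).
Hypotheses (S_T : forall x z, T (x, z) -> S z = Q x).
Hypotheses (P_T : forall x z, T (x, z) -> P z = z).
Hypotheses (Q_S : forall y, Q (S y) = S y).
Hypotheses (P_cont : continuous P) (Q_cont : continuous Q).

Let Td : set (hsum K H) := [set p | p.2 = S p.1].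
Let TTd : set (hsum K K) := rmul T Td.
Let TdT : set (hsum H H) := rmul Td T.
Let A : set (hsum (hsum H K) (hsum H K)) := roffdiag Td T.

Let TS : lin_subspace T := T_CR.1.

Lemma T_add x y x' y' : T (x, y) -> T (x', y') -> T (x + x', y + y').
Proof. by move=> h h'; exact: (subspaceD TS h h'). Qed.

Lemma T_sub x y x' y' : T (x, y) -> T (x', y') -> T (x - x', y - y').
Proof. by move=> h h'; exact: (subspaceB TS h h'). Qed.

Lemma T_scale a x y : T (x, y) -> T (a *: x, a *: y).
Proof. by move=> h; exact: (subspaceZ TS a h). Qed.

Lemma T_unscale a x y : a != 0 -> T (a *: x, a *: y) -> T (x, y).
Proof. by move=> a0 /(T_scale a^-1); rewrite !scalerA mulVf// !scale1r. Qed.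

Lemma T_domE x : exists z, T (x, z).
Proof. by have : rdom T x by rewrite T_dom. Qed.

Lemma S_P y : S (P y) = S y.
Proof. by rewrite (S_T (T_SP y)) Q_S. Qed.

Lemma P_P y : P (P y) = P y.
Proof. exact: P_T (T_SP y). Qed.

Lemma Q_Q x : Q (Q x) = Q x.
Proof. by have [z Txz] := T_domE x; rewrite -(S_T Txz) Q_S. Qed.

Lemma T_mul z : T (0, z) -> S z = 0.
Proof. by move/S_T->; rewrite linear0. Qed.

Lemma T_Sfib y z : T (S y, z) <-> T (0, z - P y).
Proof.
split=> h; first by have := T_sub h (T_SP y); rewrite subrr.
by have := T_add h (T_SP y); rewrite add0r subrK.
Qed.

Lemma T_ker x : T (x, 0) <-> Q x = 0.
Proof.
split=> [/S_T<-|Qx0]; first by rewrite linear0.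
have [z Txz] := T_domE x; have := T_sub Txz (T_SP z).
by rewrite (P_T Txz) (S_T Txz) Qx0 subr0 subrr.
Qed.

Lemma TdP y x : Td (y, x) <-> x = S y.
Proof. by []. Qed.

Lemma TTdE y z : TTd (y, z) <-> T (0, z - P y).
Proof.
split=> [[a [/TdP-> /T_Sfib]]|/T_Sfib h] //.
by exists (S y).
Qed.

Lemma TdTE x z : TdT (x, z) <-> z = Q x.
Proof.
split=> [[t [/S_T<- /TdP]]|->] //; have [t Txt] := T_domE x.
by exists t; split=> //=; rewrite -(S_T Txt).
Qed.

(** The graph of [S] is cut out by [T] and the continuous maps [P] and [Q];
    this is how it is seen to be closed. *)
Lemma TdE y x : x = S y <-> Q x = x /\ T (x, P y).
Proof.
split=> [->|[Qx /S_T]]; first by rewrite Q_S.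
by rewrite S_P Qx.
Qed.

Lemma CR_TTd : CR TTd.
Proof.
have -> : TTd =
    (fun p : hsum K K => (0, p.2 + (-1) *: P p.1) : hsum H K) @^-1` T.
  by apply/seteqP; split=> -[y z] /=; rewrite scaleN1r => /TTdE.
apply: (closed_subspace_preimage _ _ T_CR).
  move=> a [y z] [y' z']; congr pair => /=; first by rewrite scaler0 addr0.
  by rewrite linearP !scaleN1r opprD scalerBr addrACA.
apply: (@hsum_pair_continuous _ (hsum K K)); first exact: cst_continuous.
apply: (@continuousDZ _ (hsum K K)); first exact: hsum_snd_continuous.
by move=> p; apply: continuous_comp; [exact: hsum_fst_continuous|exact: P_cont].
Qed.

Lemma CR_TdT : CR TdT.
Proof.
have -> : TdT = [set p : hsum H H | p.2 = Q p.1].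
  by apply/seteqP; split=> -[x z] /TdTE.
exact: CR_graph.
Qed.

Lemma CR_offdiag : CR A.
Proof.
pose X := hsum (hsum H K) (hsum H K).
have fstc := @hsum_fst_continuous R; have sndc := @hsum_snd_continuous R.
have c1 : continuous (fun p : X => p.1.1).
  exact: (continuous_comp_fun (fstc (hsum H K) (hsum H K)) (fstc H K)).
have c2 : continuous (fun p : X => p.1.2).
  exact: (continuous_comp_fun (fstc (hsum H K) (hsum H K)) (sndc H K)).
have c3 : continuous (fun p : X => p.2.1).
  exact: (continuous_comp_fun (sndc (hsum H K) (hsum H K)) (fstc H K)).
have c4 : continuous (fun p : X => p.2.2).
  exact: (continuous_comp_fun (sndc (hsum H K) (hsum H K)) (sndc H K)).
have -> : A = (fun p : X => p.2.1) @^-1` [set u | Q u = u]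
    `&` ((fun p : X => (p.2.1, P p.1.2) : hsum H K) @^-1` T
    `&` (fun p : X => (p.1.1, p.2.2) : hsum H K) @^-1` T).
  apply/seteqP; split=> -[[x y] [u w]].
    by move=> [/TdP/TdE[Qu Tu] Tx].
  by move=> [/= Qu [Tu Tx]]; split=> //; apply/TdP/TdE.
apply: closed_subspaceI.
  apply: (@closed_subspace_preimage _ X H) => //.
  exact: closed_subspace_fixed.
apply: closed_subspaceI; apply: (closed_subspace_preimage _ _ T_CR).
- by move=> a p q; congr pair => /=; rewrite linearP.
- apply: (@hsum_pair_continuous _ X); first exact: c3.
  exact: (continuous_comp_fun c2 P_cont).
- by [].
- exact: (@hsum_pair_continuous _ X).
Qed.

Lemma ker_TTd m y : rker (Defs.rshift TTd m) y <-> T (0, m *: y - P y).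
Proof. by rewrite /rker rshiftE/= add0r; exact: TTdE. Qed.

Lemma ker_TdT m x : rker (Defs.rshift TdT m) x <-> m *: x = Q x.
Proof. by rewrite /rker rshiftE/= add0r; exact: TdTE. Qed.

Lemma ker_offdiag l x y :
  rker (Defs.rshift A l) (x, y) <-> l *: x = S y /\ T (x, l *: y).
Proof. by rewrite /rker rshiftE/= add0r. Qed.

Lemma ran_TTd m w :
  rran (Defs.rshift TTd m) w <-> exists y, T (0, w + m *: y - P y).
Proof.
rewrite /rran rshiftE.
by split=> -[y h]; exists y; apply/TTdE.
Qed.

Lemma ran_TdT m u :
  rran (Defs.rshift TdT m) u <-> exists x, u + m *: x = Q x.
Proof.
rewrite /rran rshiftE.
by split=> -[x h]; exists x; apply/TdTE.
Qed.

Lemma ran_offdiag l u w : rran (Defs.rshift A l) (u, w) <->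
  exists x y, u + l *: x = S y /\ T (x, w + l *: y).
Proof.
rewrite /rran rshiftE; split=> [[[x y] h]|[x [y h]]]; first by exists x, y.
by exists (x, y).
Qed.

(** Since [T(0)] is contained in [R(P)], applying [P] to
    [w + y - P y] in [T(0)] leaves [P w]. *)
Lemma ran_TTd1 w : rran (Defs.rshift TTd 1) w <-> T (0, P w).
Proof.
split=> [/ran_TTd[y]|h].
  by rewrite scale1r => /[dup]/P_T; rewrite linearB linearD P_P addrK => ->.
by apply/ran_TTd; exists (- w); rewrite scale1r subrr sub0r linearN opprK.
Qed.

Lemma closed_ran_TTd m : closed (rran (Defs.rshift TTd m)).
Proof.
have [->|m0] := eqVneq m 0.
  have -> : rran (Defs.rshift TTd 0) = [set w | P w = w].
    apply/seteqP; split=> w /=.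
      by move=> /ran_TTd[y]; rewrite scale0r addr0 => /T_Sfib/P_T.
    move=> Pw; apply/ran_TTd; exists w.
    by rewrite scale0r addr0 Pw subrr; exact: (subspace0 TS).
  exact: (closed_subspace_fixed P_cont).2.
have [->|m1] := eqVneq m 1.
  have -> : rran (Defs.rshift TTd 1) = (fun w => (0, P w) : hsum H K) @^-1` T.
    by apply/seteqP; split=> w /ran_TTd1.
  apply: (closed_subspace_preimage _ _ T_CR).2.
    by move=> a x y; congr pair => /=; rewrite ?linearP// scaler0 addr0.
  by apply: hsum_pair_continuous => //; exact: cst_continuous.
rewrite (_ : rran _ = setT); first exact: closedT.
apply/seteqP; split=> // w _; apply/ran_TTd.
have [y yE] := idempotent_shift_surj w P_P m0 m1.
by exists y; rewrite yE subrr; exact: (subspace0 TS).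
Qed.

Lemma closed_ran_TdT m : closed (rran (Defs.rshift TdT m)).
Proof.
have [->|m0] := eqVneq m 0.
  have -> : rran (Defs.rshift TdT 0) = [set w | Q w = w].
    apply/seteqP; split=> w /=.
      by move=> /ran_TdT[y]; rewrite scale0r addr0 => ->; rewrite Q_Q.
    by move=> Qw; apply/ran_TdT; exists w; rewrite scale0r addr0.
  exact: (closed_subspace_fixed Q_cont).2.
have [->|m1] := eqVneq m 1.
  have -> : rran (Defs.rshift TdT 1) = [set w | Q w = 0].
    apply/seteqP; split=> w /=.
      move=> /ran_TdT[x]; rewrite scale1r => h.
      by apply: (addIr (Q x)); rewrite add0r -linearD h Q_Q.
    move=> Qw; apply/ran_TdT; exists (- w).
    by rewrite scale1r subrr linearN Qw oppr0.
  by apply: (closed_subspace_ker (f := Q) _ _).2 => //; exact: linearP.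
rewrite (_ : rran _ = setT); first exact: closedT.
apply/seteqP; split=> // w _; apply/ran_TdT.
exact: idempotent_shift_surj Q_Q m0 m1.
Qed.

(** The equations [u = S y - l x], [w = z - l y] with [(x, z)] in [T] are
    solved for [x]; multiplying [z = w + l y] by [l] then leaves an equation
    in [y] alone, with [T T^+ - l^2]. *)
Lemma ran_offdiag_TTd l u w : l != 0 -> rran (Defs.rshift A l) (u, w) <->
  exists2 t, T (u, t) & rran (Defs.rshift TTd (l ^+ 2)) (l *: w + t).
Proof.
move=> l0; split=> [/ran_offdiag[x [y [uS Tx]]]|[t Tut /ran_TTd[y h]]].
  have uE : u = S y - l *: x by rewrite -uS addrK.
  (* [u = S y - l x], where [T] relates [S y] to [P y] and [x] to [w + l y]. *)
  exists (P y - l *: (w + l *: y)).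
    by rewrite uE; apply: T_sub => //; exact: T_scale.
  apply/ran_TTd; exists y.
  rewrite scalerDr scalerA -expr2 addrA [l *: w + P y]addrC opprD addrA.
  by rewrite addrK subrK subrr; exact: (subspace0 TS).
apply/ran_offdiag; exists (l^-1 *: (S y - u)), y; split.
  by rewrite scalerA divff// scale1r addrC subrK.
apply: (T_unscale l0); rewrite scalerA divff// scale1r.
have := T_sub ((T_Sfib _ _).2 h) Tut.
by rewrite [_ + t + _]addrAC addrK scalerDr scalerA.
Qed.

Lemma ran_offdiag0 : rran (Defs.rshift A 0) =
  rran (Defs.rshift TdT 0) `*` rran (Defs.rshift TTd 0).
Proof.
apply/seteqP; split=> -[u w].
  move=> /ran_offdiag[x [y]]; rewrite !scale0r !addr0 => -[-> Tx]; split=> /=.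
    by apply/ran_TdT; exists (S y); rewrite scale0r addr0 Q_S.
  apply/ran_TTd; exists w; rewrite scale0r addr0 (P_T Tx) subrr.
  exact: (subspace0 TS).
move=> [/= /ran_TdT[x uE] /ran_TTd[y h]]; apply/ran_offdiag.
have [t Tut] := T_domE x.
exists (S y), t; rewrite !scale0r !addr0 (S_T Tut) in uE h *; split=> //.
exact/T_Sfib.
Qed.

(** For [l^2 = 1], the range consists of the [(u, w)] such that [T] relates
    [u] to [- l P w]: on the part of [H * K] where [T] is bijective, [A] is an
    involution exchanging the two summands, so that the range of [A - l] is
    its eigenspace for [- l]. *)
Lemma closed_ran_offdiag l : closed (rran (Defs.rshift A l)).
Proof.
have [->|l0] := eqVneq l 0.
  rewrite ran_offdiag0; apply: closedI.
    have /continuous_closedP := @hsum_fst_continuous R H K; apply.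
    exact: closed_ran_TdT.
  have /continuous_closedP := @hsum_snd_continuous R H K; apply.
  exact: closed_ran_TTd.
have [l1|l1] := eqVneq (l ^+ 2) 1.
  pose f (p : hsum H K) : hsum H K := (p.1, 0 + (- l) *: P p.2).
  have fl : linear f.
    move=> a [u w] [u' w']; rewrite /f/= !add0r linearP scalerDr !scalerA.
    by rewrite [_ * a]mulrC -scalerA.
  have -> : rran (Defs.rshift A l) = f @^-1` T.
    apply/seteqP; split=> -[u w] /=; rewrite /f/= add0r scaleNr.
      move=> /(ran_offdiag_TTd _ _ l0)[t Tut]; rewrite l1 => /ran_TTd1.
      rewrite linearD linearZ/= (P_T Tut) => /(T_sub Tut).
      by rewrite subr0 opprD addrCA subrr addr0.
    move=> Tuw; apply/ran_offdiag_TTd => //; eexists; first exact: Tuw.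
    rewrite l1; apply/ran_TTd1.
    by rewrite linearB !linearZ/= P_P scalerN subrr; exact: (subspace0 TS).
  apply: (closed_subspace_preimage fl _ T_CR).2.
  apply: (@hsum_pair_continuous _ (hsum H K)); first exact: hsum_fst_continuous.
  apply: (@continuousDZ _ (hsum H K)); first exact: cst_continuous.
  exact: (continuous_comp_fun (@hsum_snd_continuous _ H K) P_cont).
rewrite (_ : rran _ = setT); first exact: closedT.
apply/seteqP; split=> // -[u w] _; apply/ran_offdiag_TTd => //.
have [t Tut] := T_domE u; exists t => //; apply/ran_TTd.
have [y yE] : exists y, l *: w + t + l ^+ 2 *: y = P y.
  by apply: idempotent_shift_surj => //; [exact: P_P|rewrite sqrf_eq0].
by exists y; rewrite yE subrr; exact: (subspace0 TS).
Qed.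

Lemma ker_offdiag0 : rker (Defs.rshift A 0) =
  rker (Defs.rshift TdT 0) `*` rker (Defs.rshift TTd 0).
Proof.
have kerTTd y : T (0, 0 *: y - P y) <-> 0 = S y.
  rewrite scale0r; split=> [/T_Sfib/T_ker|Sy]; first by rewrite Q_S.
  by apply/T_Sfib/T_ker; rewrite Q_S.
apply/seteqP; split=> -[x y].
  move=> /ker_offdiag; rewrite !scale0r => -[Sy /T_ker Qx]; split=> /=.
    by apply/ker_TdT; rewrite scale0r.
  by apply/ker_TTd/kerTTd.
move=> [/= /ker_TdT Qx /ker_TTd/kerTTd Sy]; apply/ker_offdiag.
by rewrite !scale0r in Qx *; split=> //; apply/T_ker.
Qed.

Lemma ker_offdiag_TTd l : l != 0 -> rker (Defs.rshift A l) =
  (fun y => (l^-1 *: S y, y)) @` rker (Defs.rshift TTd (l ^+ 2)).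
Proof.
move=> l0; apply/seteqP.
split=> [[x y] /ker_offdiag[xy Txy]|_ [y /ker_TTd h <-]].
  exists y; last by rewrite -xy scalerA mulVf// scale1r.
  by apply/ker_TTd/T_Sfib; rewrite -xy expr2 -scalerA; exact: T_scale.
apply/ker_offdiag; rewrite scalerA divff// scale1r; split=> //.
by apply: (T_unscale l0); rewrite !scalerA divff// scale1r -expr2; exact/T_Sfib.
Qed.

(** [y] is in the kernel of [T T^+ - m] when [T] relates [S y] to [m y].  If
    [Q x = m x], then [y = z / m] with [z] any value of [T] at [x] satisfies
    this and [S y = x]. *)
Lemma ker_TdT_TTd m : m != 0 ->
  rker (Defs.rshift TdT m) = S @` rker (Defs.rshift TTd m).
Proof.
move=> m0; apply/seteqP; split=> [x /ker_TdT mx|_ [y /ker_TTd/T_Sfib h <-]].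
  have [z Txz] := T_domE x.
  have xE : S (m^-1 *: z) = x.
    by rewrite linearZ/= (S_T Txz) -mx scalerA mulVf// scale1r.
  exists (m^-1 *: z) => //; apply/ker_TTd/T_Sfib.
  by rewrite xE scalerA divff// scale1r.
by apply/ker_TdT; rewrite -(S_T h) linearZ.
Qed.

Lemma fin_dim_ker_offdiag l : fin_dim (rker (Defs.rshift A l)) <->
  fin_dim (rker (Defs.rshift TTd (l ^+ 2))) /\
  fin_dim (rker (Defs.rshift TdT (l ^+ 2))).
Proof.
have [->|l0] := eqVneq l 0.
  rewrite expr0n/= ker_offdiag0 [X in _ <-> X]andC.
  by apply: fin_dim_prodP; apply: lin_subspace_rker; apply: (CR_rshift _ _).1;
    [exact: CR_TdT|exact: CR_TTd].
rewrite ker_TdT_TTd ?sqrf_eq0//; split=> [fA|[fK _]].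
  suff fK : fin_dim (rker (Defs.rshift TTd (l ^+ 2))).
    by split=> //; apply: fin_dim_image => //; exact: linearP.
  have -> : rker (Defs.rshift TTd (l ^+ 2)) =
      (fun p : hsum H K => p.2) @` rker (Defs.rshift A l).
    rewrite ker_offdiag_TTd//; apply/seteqP; split=> [y h|_ [_ [y h <-] <-]//].
    by exists (l^-1 *: S y, y) => //; exists y.
  exact: (@fin_dim_image _ (hsum H K) K).
rewrite ker_offdiag_TTd//; apply: (@fin_dim_image _ K (hsum H K)) => // a y y'.
congr pair; rewrite linearP scalerDr !scalerA.
by rewrite [_ * a]mulrC -scalerA.
Qed.

Lemma ran_TTd_mul m z : T (0, z) -> rran (Defs.rshift TTd m) z.
Proof.
by move=> Tz; apply/ran_TTd; exists 0; rewrite scaler0 addr0 linear0 subr0.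
Qed.

Let ranS_TTd m : lin_subspace (rran (Defs.rshift TTd m)).
Proof. exact/lin_subspace_rran/(CR_rshift _ CR_TTd).1. Qed.

Let ranS_TdT m : lin_subspace (rran (Defs.rshift TdT m)).
Proof. exact/lin_subspace_rran/(CR_rshift _ CR_TdT).1. Qed.

Let ranS_offdiag l : lin_subspace (rran (Defs.rshift A l)).
Proof. exact/lin_subspace_rran/(CR_rshift _ CR_offdiag).1. Qed.

(** The relation used sends [(u, w)] to all the [l w + t] with [t] in [T u];
    it need not be single-valued, but [T(0)] is contained in the range of
    [T T^+ - l^2]. *)
Lemma fin_codim_offdiag_TTd l : l != 0 -> fin_codim (rran (Defs.rshift A l)) ->
  fin_codim (rran (Defs.rshift TTd (l ^+ 2))).
Proof.
move=> l0; apply: (@fin_codim_transfer R (hsum H K) K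
  [set p : hsum (hsum H K) K | T (p.1.1, p.2 - l *: p.1.2)]) => //.
- split.
    by apply/mem_set; rewrite /= scaler0 subr0; exact: (subspace0 TS).
  move=> a [[u w] k] [[u' w'] k'] /set_mem/= h /set_mem/= h'.
  apply/mem_set => /=.
  have := T_add (T_scale a h) h'; congr (T (_, _)).
  by rewrite scalerBr scalerDr opprD addrACA !scalerA mulrC.
- apply/seteqP; split=> // -[u w] _; have [t Tut] := T_domE u.
  by exists (t + l *: w); rewrite /= addrK.
- move=> [u w] k /= Tuk /ran_offdiag_TTd[]// t Tut rt.
  rewrite -[k](subrKC (l *: w + t)).
  apply: subspaceD => //; apply: ran_TTd_mul.
  by have := T_sub Tuk Tut; rewrite subrr opprD addrA.
- move=> k; exists k; last by rewrite subrr; exact: subspace0.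
  exists (0, l^-1 *: k) => /=.
  by rewrite scalerA divff// scale1r subrr; exact: (subspace0 TS).
Qed.

(** Modulo the range of [A - l], the pair [(u, w)] is equivalent to
    [(0, w + t / l)] for any value [t] of [T] at [u]. *)
Lemma fin_codim_TTd_offdiag l : l != 0 ->
  fin_codim (rran (Defs.rshift TTd (l ^+ 2))) ->
  fin_codim (rran (Defs.rshift A l)).
Proof.
move=> l0; apply: (fin_codim_map (f := fun k : K => (0, l^-1 *: k) : hsum H K)).
- move=> a k k'; congr pair => /=; first by rewrite scaler0 addr0.
  by rewrite scalerDr !scalerA mulrC.
- exact: ranS_offdiag.
- move=> k rk; apply/ran_offdiag_TTd => //.
  exists 0; first exact: (subspace0 TS).
  by rewrite scalerA divff// scale1r addr0.
- move=> [u w]; have [t Tut] := T_domE u; exists (l *: w + t).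
  apply/ran_offdiag_TTd => //; exists t; first by rewrite subr0.
  rewrite scalerBr scalerA divff// scale1r opprD addrA subrr sub0r addNr.
  exact: subspace0.
Qed.

(** [x - Q x] is in the kernel of [Q], hence in the range of [Q - m] when
    [m != 0]; so every [x] is equivalent to [Q x = S t], [t] in [T x]. *)
Lemma fin_codim_TTd_TdT m : m != 0 ->
  fin_codim (rran (Defs.rshift TTd m)) -> fin_codim (rran (Defs.rshift TdT m)).
Proof.
move=> m0; apply: (fin_codim_map (f := S)) => //; first exact: linearP.
- move=> k /ran_TTd[y /T_mul h]; apply/ran_TdT; exists (S y).
  by move: h; rewrite linearB linearD linearZ/= S_P Q_S => /subr0_eq.
- move=> x; have [t Txt] := T_domE x; exists t; apply/ran_TdT.
  exists (- m^-1 *: (x - Q x)).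
  by rewrite (S_T Txt) scalerA mulrN divff// scaleN1r subrr linearZ linearB/=
    Q_Q subrr scaler0.
Qed.

Lemma fin_codim_ran_offdiag l : fin_codim (rran (Defs.rshift A l)) <->
  fin_codim (rran (Defs.rshift TTd (l ^+ 2))) /\
  fin_codim (rran (Defs.rshift TdT (l ^+ 2))).
Proof.
have [->|l0] := eqVneq l 0.
  rewrite expr0n/= ran_offdiag0 [X in _ <-> X]andC.
  exact: fin_codim_prodP.
split=> [/(fin_codim_offdiag_TTd l0) fK|[fK _]]; last first.
  exact: fin_codim_TTd_offdiag.
by split=> //; apply: fin_codim_TTd_TdT => //; rewrite sqrf_eq0.
Qed.

Lemma phi_plus_offdiag l : phi_plus (Defs.rshift A l) <->
  phi_plus (Defs.rshift TTd (l ^+ 2)) /\ phi_plus (Defs.rshift TdT (l ^+ 2)).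
Proof.
split=> [[_ _ /fin_dim_ker_offdiag[fK fH]]|[[_ _ fK] [_ _ fH]]].
  by split; split=> //;
    [exact/CR_rshift/CR_TTd|exact: closed_ran_TTd
    |exact/CR_rshift/CR_TdT|exact: closed_ran_TdT].
split; [exact/CR_rshift/CR_offdiag|exact: closed_ran_offdiag|].
exact/fin_dim_ker_offdiag.
Qed.

Lemma phi_minus_offdiag l : phi_minus (Defs.rshift A l) <->
  phi_minus (Defs.rshift TTd (l ^+ 2)) /\ phi_minus (Defs.rshift TdT (l ^+ 2)).
Proof.
split=> [[_ _ /fin_codim_ran_offdiag[fK fH]]|[[_ _ fK] [_ _ fH]]].
  by split; split=> //;
    [exact/CR_rshift/CR_TTd|exact: closed_ran_TTd
    |exact/CR_rshift/CR_TdT|exact: closed_ran_TdT].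
split; [exact/CR_rshift/CR_offdiag|exact: closed_ran_offdiag|].
exact/fin_codim_ran_offdiag.
Qed.
End Blocks.

(** * The Moore-Penrose inverse of a relation with closed range *)

(** [S] is obtained by choosing a preimage of [P y] and projecting it away from
    [N(T)]: two preimages differ by an element of [N(T)], so the outcome is
    independent of the choice, hence linear in [y]. *)
Theorem moore_penrose_operator (R : realType) (H K : hilbertType R)
    (T : set (hsum H K)) :
  CR T -> closed (rran T) -> rdom T = [set: H] ->
  exists (P : {linear K -> K}) (Q : {linear H -> H}) (S : {linear K -> H}),
    [/\ continuous P, continuous Q &
    [/\ rpinv T = [set p | p.2 = S p.1],
        forall y, T (S y, P y),
        forall x z, T (x, z) -> S z = Q x,
        forall x z, T (x, z) -> P z = z
      & forall y, Q (S y) = S y]].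
Proof.
move=> T_CR T_ran T_dom; have TS := T_CR.1.
have ranS := lin_subspace_rran TS; have kerS := lin_subspace_rker TS.
have kerc : closed (rker T).
  apply: (closed_subspace_preimage
    (f := fun x : H => (x, 0) : hsum H K) _ _ T_CR).2.
    by move=> a x x'; congr pair => /=; rewrite scaler0 addr0.
  apply: hsum_pair_continuous; last exact: cst_continuous.
  by move=> x; exact: cvg_id.
have [P [P_cont P_ran P_orth]] := orthogonal_projection ranS T_ran.
have [N [N_cont N_ker N_orth]] := orthogonal_projection kerS kerc.
pose Q : {linear H -> H} := idfun \- N.
have QE x : Q x = x - N x by [].
have Q_ker x : rker T x -> Q x = 0.
  move=> kx; rewrite QE; apply/eqP; rewrite subr_eq0; apply/eqP.
  apply: (projection_unique kerS kx _ (N_ker x) (N_orth x)).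
  by move=> w _; rewrite subrr linear0l.
have Q_T x x' z : T (x, z) -> T (x', z) -> Q x = Q x'.
  move=> Txz Tx'z; apply/eqP; rewrite -subr_eq0 -linearB; apply/eqP/Q_ker.
  by have := subspaceB TS Txz Tx'z; congr (T (_, _)); rewrite /= subrr.
have P_T x z : T (x, z) -> P z = z.
  move=> Txz; apply: (projection_unique ranS (P_ran z) (P_orth z)).
    by exists x.
  by move=> w _; rewrite subrr linear0l.
have /choice[g Tg] y : exists x, T (x, P y) by exact: P_ran.
have S_lin : linear (Q \o g).
  move=> a y y'; rewrite /comp -[RHS](linearP Q a (g y) (g y')).
  apply: Q_T (Tg _) _.
  by rewrite linearP; exact: (subspace_lin TS a (Tg y) (Tg y')).
pose mix := GRing.isLinear.Build R[i] K H *:%R (Q \o g) S_lin.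
pose S : {linear K -> H} := HB.pack (Q \o g) mix.
have SE y : S y = Q (g y) by [].
exists P, Q, S; split=> //.
  by move=> x; apply: cvgB; [exact: cvg_id|exact: N_cont].
split=> //.
(* The projection in [rpinv] is onto the complement of [N(T)], so it requires
   [x - Q x] to be in the double complement; it even is in [N(T)]. *)
- have bi_orth x : orthoc (orthoc (rker T)) (x - Q x).
    move=> w /(_ _ (N_ker x)) /eqP; rewrite QE opprB addrC subrK.
    by rewrite herm_eq0C => /eqP.
  apply/seteqP; split=> -[y x] /=.
    move=> [z [[w [[/= Rw yw] Tzw]] [/= Nx zx]]].
    have -> : x = Q z.
      apply: (projection_unique (@orthoc_subspace _ _ _) Nx zx) => //.
      exact: N_orth.
    apply: Q_T Tzw _.
    by rewrite (projection_unique ranS Rw yw (P_ran y) (P_orth y)).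
  move=> ->; exists (g y); split; last by split=> //; exact: N_orth.
  exists (P y); split; last exact: Tg.
  by split; [exact: P_ran|exact: P_orth].
- move=> y; rewrite SE; have := subspaceB TS (Tg y) (N_ker (g y)).
  by congr (T (_, _)); rewrite /= subr0.
- move=> x z Txz; rewrite SE; apply: (Q_T _ _ z _ Txz).
  by have := Tg z; rewrite (P_T _ _ Txz).
- move=> y; rewrite SE; set w := g y.
  have -> : Q (Q w) = Q w - Q (N w) by rewrite -linearB.
  by rewrite (Q_ker _ (N_ker w)) subr0.
Qed.

(** * The essential spectra *)

Theorem corollary4p8 (R : realType) (H K : hilbertType R)
  (T : set (hsum H K)) (T_CR : CR T) (T_ran : closed (rran T))
  (T_dom : rdom T = [set: H]) :
  let Td : set (hsum K H) := rpinv T in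
  let TTd : set (hsum K K) := rmul T Td in
  let TdT : set (hsum H H) := rmul Td T in
  let A : set (hsum (hsum H K) (hsum H K)) := roffdiag Td T in
  [/\ sigma_e1 A = [set l : R[i] | (sigma_e1 TTd `|` sigma_e1 TdT) (l ^+ 2)],
      sigma_e2 A = [set l : R[i] | (sigma_e2 TTd `|` sigma_e2 TdT) (l ^+ 2)],
      sigma_e3 A = [set l : R[i] |
        (sigma_e3 TTd `|` sigma_e3 TdT
         `|` (sigma_e1 TdT `&` sigma_e2 TTd)
         `|` (sigma_e2 TdT `&` sigma_e1 TTd)) (l ^+ 2)]
    & sigma_e4 A = [set l : R[i] | (sigma_e4 TTd `|` sigma_e4 TdT) (l ^+ 2)]].
Proof.
move=> Td TTd TdT A.
have [P [Q [S [P_cont Q_cont [TdE T_SP S_T P_T Q_S]]]]] :=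
  moore_penrose_operator T_CR T_ran T_dom.
have plusE := phi_plus_offdiag T_CR T_dom T_SP S_T P_T Q_S P_cont Q_cont.
have minusE := phi_minus_offdiag T_CR T_dom T_SP S_T P_T Q_S P_cont Q_cont.
rewrite -TdE -/Td -/TTd -/TdT -/A in plusE minusE.
(* Writing both sides through the four memberships of [T T^+ - l^2] and
   [T^+ T - l^2] in [phi_+] and [phi_-], each identity is a tautology. *)
split; apply/seteqP; split=> l;
  rewrite /sigma_e1 /sigma_e2 /sigma_e3 /sigma_e4 /setU /setI /=;
  have := plusE l; have := minusE l;
  have [] := pselect (phi_plus (Defs.rshift TTd (l ^+ 2)));
  have [] := pselect (phi_plus (Defs.rshift TdT (l ^+ 2)));
  have [] := pselect (phi_minus (Defs.rshift TTd (l ^+ 2)));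
  have [] := pselect (phi_minus (Defs.rshift TdT (l ^+ 2)));
  tauto.
Qed.
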